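(* Assume the consistency of ZF. Then there is a model of $\mathrm{ZFU}_{\mathrm{R}}$ in which the $\mathrm{DC}_\omega$-scheme holds, RP holds, and homogeneity holds over no set of urelements.
   Context: The language of urelement set theory has $\in$ and a unary predicate $\mathcal{A}$ for urelements. $\mathrm{ZFU}_{\mathrm{R}}$ = ZU (urelements have no members, Extensionality for sets, Foundation, Pairing, Union, Powerset, Infinity, Separation scheme) + Replacement scheme. $\mathrm{DC}_\omega$-scheme: for every formula $\varphi$ and $u$, if $\forall x\exists y\,\varphi(x,y,u)$ then there is a function $f$ on $\omega$ with $\varphi(f\restriction n,f(n),u)$ for all $n$. RP (scheme): for each formula $\varphi$, for every set $x$ there is a transitive set $t\supseteq x$ with $\varphi(x_1,\dots,x_n)\leftrightarrow\varphi^t(x_1,\dots,x_n)$ for all $x_1,\dots,x_n\in t$. A permutation $\pi$ of a set of urelements is extended to an automorphism of the universe by letting $\pi a=a$ for other urelements and $\pi x=\{\pi y:y\in x\}$ for sets. Homogeneity holds over a set $A$ of urelements if whenever $B,C$ are equinumerous sets of urelements with $B\cup C$ disjoint from $A$, there is such an automorphism $\pi$ with $\pi B=C$ and $\pi a=a$ for every $a\in A$. *)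

(* Defs.v *)
From Stdlib Require Import List Arith.

Set Implicit Arguments.
Unset Strict Implicit.

(** * First-order logic *)

(** Formulas over equality, a binary [∈], and the unary predicate symbols [P];
    variables are de Bruijn indices.  [P := Empty_set] is the language of set
    theory, [P := unit] the language with one extra predicate for urelements. *)
Inductive form (P : Type) : Type :=
| Fal : form P
| Eq : nat -> nat -> form P
| Mem : nat -> nat -> form P
| Pred : P -> nat -> form P
| Imp : form P -> form P -> form P
| All : form P -> form P.

Arguments Fal {P}.
Arguments Eq {P} _ _.
Arguments Mem {P} _ _.

Definition Neg P (φ : form P) := Imp φ Fal.
Definition And P (φ ψ : form P) := Neg (Imp φ (Neg ψ)).
Definition Or P (φ ψ : form P) := Imp (Neg φ) ψ.
Definition Iff P (φ ψ : form P) := And (Imp φ ψ) (Imp ψ φ).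
Definition Ex P (φ : form P) := Neg (All (Neg φ)).

Fixpoint free P (φ : form P) (k : nat) : Prop :=
  match φ with
  | Fal => False
  | Eq i j | Mem i j => i = k \/ j = k
  | Pred _ i => i = k
  | Imp φ ψ => free φ k \/ free ψ k
  | All φ => free φ (S k)
  end.

Definition up (r : nat -> nat) (i : nat) : nat :=
  match i with 0 => 0 | S j => S (r j) end.

Fixpoint ren P (r : nat -> nat) (φ : form P) : form P :=
  match φ with
  | Fal => Fal
  | Eq i j => Eq (r i) (r j)
  | Mem i j => Mem (r i) (r j)
  | Pred p i => Pred p (r i)
  | Imp φ ψ => Imp (ren r φ) (ren r ψ)
  | All φ => All (ren (up r) φ)
  end.

(** [inst i φ] is the body [φ] of a quantifier with the bound variable replaced
    by [i]. *)
Definition inst P (i : nat) (φ : form P) : form P :=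
  ren (fun k => match k with 0 => i | S j => j end) φ.

(** Classical natural deduction with equality. *)
Inductive prv P : list (form P) -> form P -> Prop :=
| prv_hyp Γ φ : In φ Γ -> prv Γ φ
| prv_impI Γ φ ψ : prv (φ :: Γ) ψ -> prv Γ (Imp φ ψ)
| prv_impE Γ φ ψ : prv Γ (Imp φ ψ) -> prv Γ φ -> prv Γ ψ
| prv_allI Γ φ : prv (map (ren S) Γ) φ -> prv Γ (All φ)
| prv_allE Γ φ i : prv Γ (All φ) -> prv Γ (inst i φ)
| prv_dne Γ φ : prv Γ (Neg (Neg φ)) -> prv Γ φ
| prv_refl Γ i : prv Γ (Eq i i)
| prv_subst Γ φ i j : prv Γ (Eq i j) -> prv Γ (inst i φ) -> prv Γ (inst j φ).

Definition provable P (T : form P -> Prop) (φ : form P) : Prop :=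
  exists Γ, (forall ψ, In ψ Γ -> T ψ) /\ prv Γ φ.

Definition consistent P (T : form P -> Prop) : Prop := ~ provable T Fal.

(** * The theory ZF *)

Section ZFAxioms.
Local Notation sform := (form Empty_set).
Local Notation "i ≐ j" := (Eq i j) (at level 60).
Local Notation "i ∊ j" := (Mem i j) (at level 60).
Local Notation "¬ φ" := (Neg φ) (at level 65, right associativity).
Local Notation "φ ∧ ψ" := (And φ ψ) (at level 80, right associativity).
Local Notation "φ ∨ ψ" := (Or φ ψ) (at level 85, right associativity).
Local Notation "φ ⟶ ψ" := (Imp φ ψ) (at level 90, right associativity).
Local Notation "φ ⟷ ψ" := (Iff φ ψ) (at level 95).
Local Notation "∀ φ" := (All φ) (at level 65, right associativity).
Local Notation "∃ φ" := (Ex φ) (at level 65, right associativity).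

(** ∀x ∀y (∀z (z ∈ x ↔ z ∈ y) → x = y) *)
Definition ax_ext : sform :=
  ∀ ∀ ((∀ (0 ∊ 2 ⟷ 0 ∊ 1)) ⟶ 1 ≐ 0).

(** ∀x (∃y y ∈ x → ∃y (y ∈ x ∧ ¬∃z (z ∈ y ∧ z ∈ x))) *)
Definition ax_found : sform :=
  ∀ ((∃ (0 ∊ 1)) ⟶ ∃ (0 ∊ 1 ∧ ¬ ∃ (0 ∊ 1 ∧ 0 ∊ 2))).

(** ∀x ∀y ∃z ∀v (v ∈ z ↔ v = x ∨ v = y) *)
Definition ax_pair : sform :=
  ∀ ∀ ∃ ∀ (0 ∊ 1 ⟷ 0 ≐ 3 ∨ 0 ≐ 2).

(** ∀x ∃y ∀z (z ∈ y ↔ ∃w (w ∈ x ∧ z ∈ w)) *)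
Definition ax_union : sform :=
  ∀ ∃ ∀ (0 ∊ 1 ⟷ ∃ (0 ∊ 3 ∧ 1 ∊ 0)).

(** ∀x ∃y ∀z (z ∈ y ↔ ∀w (w ∈ z → w ∈ x)) *)
Definition ax_power : sform :=
  ∀ ∃ ∀ (0 ∊ 1 ⟷ ∀ (0 ∊ 1 ⟶ 0 ∊ 3)).

(** ∃s (∃y (y ∈ s ∧ ∀z z ∉ y) ∧
        ∀x (x ∈ s → ∃y (y ∈ s ∧ ∀z (z ∈ y ↔ z ∈ x ∨ z = x)))) *)
Definition ax_inf : sform :=
  ∃ ((∃ (0 ∊ 1 ∧ ∀ ¬ (0 ∊ 1))) ∧
      ∀ (0 ∊ 1 ⟶ ∃ (0 ∊ 2 ∧ ∀ (0 ∊ 1 ⟷ 0 ∊ 2 ∨ 0 ≐ 2)))).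

Definition place1 (z n k : nat) : nat :=
  match k with 0 => z | S j => j + n end.

Definition place2 (x y n k : nat) : nat :=
  match k with 0 => x | 1 => y | S (S j) => j + n end.

(** ∀x ∃y ∀z (z ∈ y ↔ z ∈ x ∧ φ(z, u)); in [φ], index 0 is z and the
    indices k ≥ 1 are the parameters u. *)
Definition ax_sep (φ : sform) : sform :=
  ∀ ∃ ∀ (0 ∊ 1 ⟷ 0 ∊ 2 ∧ ren (place1 0 3) φ).

(** ∀w (∀x (x ∈ w → ∃y ∀y' (φ(x, y', u) ↔ y' = y)) →
        ∃v ∀x (x ∈ w → ∃y (y ∈ v ∧ φ(x, y, u)))); in [φ], index 0 is x,
    index 1 is y and the indices k ≥ 2 are the parameters u. *)
Definition ax_repl (φ : sform) : sform :=
  ∀ ((∀ (0 ∊ 1 ⟶ ∃ ∀ (ren (place2 2 0 4) φ ⟷ 0 ≐ 1))) ⟶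
      ∃ ∀ (0 ∊ 2 ⟶ ∃ (0 ∊ 2 ∧ ren (place2 1 0 4) φ))).

End ZFAxioms.

(** [ψ] is a universal closure of [χ]. *)
Definition closure_of P (χ ψ : form P) : Prop :=
  exists n, ψ = Nat.iter n (@All P) χ /\ forall k, ~ free ψ k.

Inductive ZF : form Empty_set -> Prop :=
| ZF_ext : ZF ax_ext
| ZF_found : ZF ax_found
| ZF_pair : ZF ax_pair
| ZF_union : ZF ax_union
| ZF_power : ZF ax_power
| ZF_inf : ZF ax_inf
| ZF_sep φ ψ : closure_of (ax_sep φ) ψ -> ZF ψ
| ZF_repl φ ψ : closure_of (ax_repl φ) ψ -> ZF ψ.

(** * Structures for set theory with urelements *)

Record structure : Type := Structure {
  carrier :> Type;
  mem : carrier -> carrier -> Prop;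
  urel : carrier -> Prop
}.

Notation "x ∈ y" := (mem x y) (at level 70).
Notation "x ∉ y" := (~ mem x y) (at level 70).

Definition scons (X : Type) (x : X) (e : nat -> X) (k : nat) : X :=
  match k with 0 => x | S j => e j end.

Notation "x .: e" := (scons x e) (at level 55, right associativity).

(** Satisfaction with all quantifiers relativized to [D]. *)
Fixpoint sat_in (M : structure) (D : M -> Prop) (φ : form unit) (e : nat -> M)
  : Prop :=
  match φ with
  | Fal => False
  | Eq i j => e i = e j
  | Mem i j => e i ∈ e j
  | Pred _ i => urel (e i)
  | Imp φ ψ => sat_in D φ e -> sat_in D ψ e
  | All φ => forall x, D x -> sat_in D φ (x .: e)
  end.

Definition sat (M : structure) (φ : form unit) (e : nat -> M) : Prop :=
  sat_in (fun _ => True) φ e.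

Section SetNotions.
Context {M : structure}.
Implicit Types (x y z f g p d w A B C D : M).

Definition is_set x : Prop := ~ urel x.

Definition empty x : Prop := is_set x /\ forall z, z ∉ x.

Definition subset x y : Prop := forall z, z ∈ x -> z ∈ y.

Definition transitive x : Prop := is_set x /\ forall y, y ∈ x -> subset y x.

(** y = x ∪ {x} *)
Definition succ x y : Prop := is_set y /\ forall z, z ∈ y <-> z ∈ x \/ z = x.

Definition inductive_set x : Prop :=
  is_set x /\ (exists y, empty y /\ y ∈ x) /\
  forall y, y ∈ x -> exists z, succ y z /\ z ∈ x.

Definition is_omega w : Prop :=
  inductive_set w /\ forall x, inductive_set x -> subset w x.

(** z = {x, y} *)
Definition upair x y z : Prop :=
  is_set z /\ forall v, v ∈ z <-> v = x \/ v = y.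

(** p = (x, y) *)
Definition opair x y p : Prop :=
  exists s t, upair x x s /\ upair x y t /\ upair s t p.

(** (x, y) ∈ f *)
Definition maps f x y : Prop := exists p, opair x y p /\ p ∈ f.

Definition function_on f d : Prop :=
  is_set f /\ is_set d /\
  (forall p, p ∈ f -> exists x y, x ∈ d /\ opair x y p) /\
  forall x, x ∈ d -> exists! y, maps f x y.

Definition bijection f B C : Prop :=
  function_on f B /\ is_set C /\
  (forall x y, maps f x y -> y ∈ C) /\
  forall y, y ∈ C -> exists! x, maps f x y.

Definition equinumerous B C : Prop := exists f, bijection f B C.

(** g = f ↾ n *)
Definition restriction f n g : Prop :=
  is_set g /\ forall p, p ∈ g <-> p ∈ f /\ exists x y, x ∈ n /\ opair x y p.

Definition urel_set A : Prop := is_set A /\ forall a, a ∈ A -> urel a.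

Definition urel_perm p : Prop := exists D, urel_set D /\ bijection p D D.

(** [f] is an approximation, with transitive domain [d], to the automorphism
    π of the universe that extends the permutation [p]. *)
Definition approximation p f d : Prop :=
  transitive d /\ function_on f d /\
  (forall a b, a ∈ d -> urel a -> maps p a b -> maps f a b) /\
  (forall a, a ∈ d -> urel a -> ~ (exists b, maps p a b) -> maps f a a) /\
  (forall x y, is_set x -> maps f x y ->
     is_set y /\ forall z, z ∈ y <-> exists v, v ∈ x /\ maps f v z).

(** π x = y, for the automorphism π extending [p], which is defined by
    recursion on ∈. *)
Definition extension p x y : Prop :=
  exists f d, approximation p f d /\ maps f x y.

Definition homogeneous_over A : Prop :=
  forall B C, urel_set B -> urel_set C -> equinumerous B C ->
    (forall a, a ∈ A -> a ∉ B /\ a ∉ C) ->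
    exists p, urel_perm p /\ extension p B C /\
      forall a, a ∈ A -> extension p a a.

End SetNotions.

(** * Axioms and schemes for structures with urelements *)

Record ZU (M : structure) : Prop := {
  urelements_empty : forall a x : M, urel a -> x ∉ a;
  extensionality : forall x y : M, is_set x -> is_set y ->
    (forall z, z ∈ x <-> z ∈ y) -> x = y;
  foundation : forall x : M, (exists y, y ∈ x) ->
    exists y, y ∈ x /\ ~ exists z, z ∈ y /\ z ∈ x;
  pairing : forall x y : M, exists z, upair x y z;
  union : forall x : M, exists y, is_set y /\
    forall z, z ∈ y <-> exists v, v ∈ x /\ z ∈ v;
  powerset : forall x : M, exists y, is_set y /\
    forall z, z ∈ y <-> is_set z /\ subset z x;
  infinity : exists x : M, inductive_set x;
  separation : forall (φ : form unit) (e : nat -> M) (x : M),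
    exists y, is_set y /\ forall z, z ∈ y <-> z ∈ x /\ sat φ (z .: e)
}.

Definition replacement (M : structure) : Prop :=
  forall (φ : form unit) (e : nat -> M) (w : M),
    (forall x, x ∈ w -> exists! y, sat φ (x .: y .: e)) ->
    exists v, is_set v /\
      forall x, x ∈ w -> exists y, y ∈ v /\ sat φ (x .: y .: e).

Definition ZFU_R (M : structure) : Prop := ZU M /\ replacement M.

Definition DC_omega_scheme (M : structure) : Prop :=
  forall (φ : form unit) (e : nat -> M),
    (forall x, exists y, sat φ (x .: y .: e)) ->
    exists w f : M, is_omega w /\ function_on f w /\
      forall n, n ∈ w -> exists g y,
        restriction f n g /\ maps f n y /\ sat φ (g .: y .: e).

Definition RP (M : structure) : Prop :=
  forall (φ : form unit) (x : M), is_set x ->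
    exists t, transitive t /\ subset x t /\
      forall e : nat -> M, (forall k, free φ k -> e k ∈ t) ->
        (sat φ e <-> sat_in (fun y => y ∈ t) φ e).

(* Main.v *)
Require Import Defs.
From Stdlib Require Import Arith Lia Bool Cantor.
From Stdlib Require Import ClassicalEpsilon FunctionalExtensionality
  PropExtensionality ProofIrrelevance.

(** Trees branching over small types form a universe of well-founded sets inside
    the ambient type theory, which interprets full choice, so the model is a
    permutation model over it and the consistency of ZF is not drawn upon.
    The urelements are the (k, n, b) with k a label, n a natural number and b a
    bit, where a label is a pair (i, t) of a tree i and a binary sequence t.
    The group is that of all maps π from labels to bits, acting by
    (k, n, b) ↦ (k, n, b xor π k), and supports are countable sets of labels.
    Countable unions of supports are supports, hence DC; closing a set
    ω times under members, Skolem functions and the (small) orbits gives an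
    invariant reflecting set, hence RP.  Given A, there is a tree i that does not
    occur in A.  Let B consist of all ((i, t), n, b) and C of those with n > 0;
    they are equinumerous by n ↦ n + 1.  If a permutation p takes B to C, the
    points of B with n = 0 come from outside of B.  Take t such that (i, t) is
    outside the support of p: the flip at (i, t) fixes p and everything outside
    of B, but not ((i, t), 0, b), a contradiction. *)

Set Implicit Arguments.
Unset Strict Implicit.

(** * Urelements, well-founded trees and the group of flips *)

(** Branching is over arbitrary types of a universe, so no single such type can list all trees: a
    node placed above the listed ones would be missing. *)
Inductive tree : Type := node (A : Type) (f : A -> tree).

Lemma node_not_child A (f : A -> tree) a : f a <> node f.
Proof.
  (* Naming the child [v] lets the induction run on it: were [v] equal to [node f], its own child
     [f a] would be a smaller counterexample. *)
  enough (H : forall v A (f : A -> tree) a, f a = v -> v <> node f) by eauto.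
  clear. induction v as [B g IH]. intros A f a Ha E.
  injection E as -> E2. apply inj_pair2 in E2. subst g.
  exact (IH a A f a eq_refl Ha).
Qed.

(** The trees supply a proper class of labels, to escape any given set. The binary sequences supply
    uncountably many labels for each tree, to escape any countable support. *)
Definition label : Type := tree * (nat -> bool).
Definition atom : Type := label * nat * bool.

Definition flip (π : label -> bool) (u : atom) : atom :=
  let '(k, n, b) := u in (k, n, xorb b (π k)).

(** Aczel's iterative sets, here over urelements; the later [eqv] is bisimilarity, that is,
    extensional equality. *)
Inductive pre : Type :=
| ur (u : atom)
| sup (A : Type) (f : A -> pre).

Fixpoint eqv (x y : pre) : Prop :=
  match x, y with
  | ur u, ur v => u = v
  | sup f, sup g =>
      (forall a, exists b, eqv (f a) (g b)) /\ (forall b, exists a, eqv (f a) (g b))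
  | _, _ => False
  end.

Lemma eqv_refl x : eqv x x.
Proof. induction x; simpl; eauto. Qed.

Lemma eqv_sym x y : eqv x y -> eqv y x.
Proof.
  revert y. induction x as [u|A f IH]; intros [v|B g]; simpl; auto.
  intros [H1 H2]. split; intros c.
  - destruct (H2 c) as [a Ha]. eauto.
  - destruct (H1 c) as [b Hb]. eauto.
Qed.

Lemma eqv_trans x y z : eqv x y -> eqv y z -> eqv x z.
Proof.
  revert y z. induction x as [u|A f IH]; intros [v|B g] [w|C h]; simpl;
    try tauto; try congruence.
  intros [H1 H2] [H3 H4]. split; intros c.
  - destruct (H1 c) as [b Hb]. destruct (H3 b) as [d Hd]. eauto.
  - destruct (H4 c) as [b Hb]. destruct (H2 b) as [a Ha]. eauto.
Qed.

Definition pmem (x y : pre) : Prop :=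
  match y with ur _ => False | sup f => exists a, eqv x (f a) end.

Lemma pmem_eqv x x' y y' : eqv x x' -> eqv y y' -> pmem x y -> pmem x' y'.
Proof.
  destruct y as [u|A f], y' as [v|B g]; simpl; try tauto.
  intros Hx [H1 _] [a Ha]. destruct (H1 a) as [b Hb]. exists b.
  eapply eqv_trans; [apply eqv_sym, Hx|]. eapply eqv_trans; eauto.
Qed.

Fixpoint pact (π : label -> bool) (x : pre) : pre :=
  match x with
  | ur u => ur (flip π u)
  | sup f => sup (fun a => pact π (f a))
  end.

Lemma pact_eqv π x y : eqv x y -> eqv (pact π x) (pact π y).
Proof.
  revert y. induction x as [u|A f IH]; intros [v|B g]; simpl; try tauto.
  - congruence.
  - intros [H1 H2]. split; intros c.
    + destruct (H1 c) as [b Hb]. eauto.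
    + destruct (H2 c) as [a Ha]. eauto.
Qed.

Lemma flip_flip π u : flip π (flip π u) = u.
Proof.
  destruct u as [[k n] b]. simpl.
  now rewrite xorb_assoc, xorb_nilpotent, xorb_false_r.
Qed.

Lemma pact_pact π x : pact π (pact π x) = x.
Proof.
  induction x as [u|A f IH]; simpl.
  - now rewrite flip_flip.
  - f_equal. now apply functional_extensionality.
Qed.

Lemma pact_comm π σ x : pact π (pact σ x) = pact σ (pact π x).
Proof.
  induction x as [[[k n] b]|A f IH]; simpl.
  - now rewrite !xorb_assoc, (xorb_comm (π k)).
  - f_equal. now apply functional_extensionality.
Qed.

Lemma pact_mem π x y : pmem x y -> pmem (pact π x) (pact π y).
Proof.
  destruct y as [u|A f]; simpl; auto.
  intros [a Ha]. exists a. now apply pact_eqv.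
Qed.

(** * Hereditarily symmetric sets *)

(** [E] lists a countable set of labels. A map that is false on them leaves all urelements with
    these labels in place, so [sym] says that [x] has a countable support. *)
Definition fixes (π : label -> bool) (E : nat -> label) : Prop :=
  forall n, π (E n) = false.

Definition sym (x : pre) : Prop :=
  exists E, forall π, fixes π E -> eqv (pact π x) x.

Fixpoint hsym (x : pre) : Prop :=
  sym x /\ match x with ur _ => True | sup f => forall a, hsym (f a) end.

Lemma sym_eqv x y : eqv x y -> sym x -> sym y.
Proof.
  intros H [E HE]. exists E. intros π Hπ.
  eapply eqv_trans; [apply pact_eqv, eqv_sym, H|].
  eapply eqv_trans; [apply HE, Hπ|exact H].
Qed.

Lemma hsym_eqv x y : eqv x y -> hsym x -> hsym y.
Proof.
  revert y. induction x as [u|A f IH]; intros [v|B g] H.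
  - intros [Hs _]. split; [eapply sym_eqv; eauto|exact I].
  - contradiction.
  - contradiction.
  - intros [Hs Hf]. split; [eapply sym_eqv; eauto|].
    intros b. destruct H as [_ H]. destruct (H b) as [a Ha]. eauto.
Qed.

(* The group is abelian, so that an element and its translates have the same
   supports. *)
Lemma hsym_pact π x : hsym x -> hsym (pact π x).
Proof.
  assert (S : forall x, sym x -> sym (pact π x)).
  { intros y [E HE]. exists E. intros σ Hσ. rewrite pact_comm.
    now apply pact_eqv, HE. }
  induction x as [u|A f IH]; intros [Hs Hf]; split; try exact I.
  - exact (S _ Hs).
  - exact (S _ Hs).
  - intros a. now apply IH.
Qed.

Lemma hsym_sym x : hsym x -> sym x.
Proof. destruct x; intros [H _]; exact H. Qed.

Lemma hsym_ur u : hsym (ur u).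
Proof.
  split; [|exact I]. destruct u as [[k n] b]. exists (fun _ => k).
  intros π Hπ. simpl. now rewrite (Hπ 0), xorb_false_r.
Qed.

(** * The model *)

(* Representatives of the classes of [eqv] turn it into Leibniz equality. *)
Definition canon (x : pre) : pre := epsilon (inhabits x) (eqv x).

Lemma canon_eqv x : eqv x (canon x).
Proof. unfold canon. apply epsilon_spec. exists x. apply eqv_refl. Qed.

Lemma canon_eq x y : eqv x y -> canon x = canon y.
Proof.
  intros H. unfold canon.
  replace (eqv y) with (eqv x).
  - f_equal. apply proof_irrelevance.
  - apply functional_extensionality. intros z. apply propositional_extensionality.
    split; intros; eapply eqv_trans; eauto using eqv_sym.
Qed.

Definition point : Type := {x : pre | hsym x /\ canon x = x}.

Definition Model : structure :=
  @Structure point (fun x y => pmem (proj1_sig x) (proj1_sig y))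
    (fun x => exists u, proj1_sig x = ur u).

Definition val (x : Model) : pre := proj1_sig x.

Lemma val_hsym (x : Model) : hsym (val x).
Proof. exact (proj1 (proj2_sig x)). Qed.

Lemma val_inj (x y : Model) : eqv (val x) (val y) -> x = y.
Proof.
  destruct x as [x [Hx Cx]], y as [y [Hy Cy]]. simpl. intros H.
  assert (x = y) as -> by (rewrite <- Cx, <- Cy; now apply canon_eq).
  f_equal. apply proof_irrelevance.
Qed.

Lemma point_of (x : pre) : hsym x -> exists y : Model, eqv (val y) x.
Proof.
  intros H. assert (E := canon_eqv x).
  unshelve eexists (exist _ (canon x) _).
  - split; [eapply hsym_eqv; eauto|]. symmetry. now apply canon_eq.
  - now apply eqv_sym.
Qed.

Definition cls (x : pre) (H : hsym x) : Model :=
  proj1_sig (constructive_indefinite_description _ (point_of H)).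

Lemma val_cls x (H : hsym x) : eqv (val (cls H)) x.
Proof. unfold cls. now destruct constructive_indefinite_description. Qed.

Lemma urel_eqv (x : Model) : urel x <-> exists u, eqv (val x) (ur u).
Proof.
  split; intros [u H]; exists u.
  - change (val x = ur u) in H. rewrite H. reflexivity.
  - change (val x = ur u). destruct (val x); [now simpl in H; subst|contradiction].
Qed.

Lemma is_set_sup (x : Model) A (f : A -> pre) : eqv (val x) (sup f) -> is_set x.
Proof.
  intros H [u E]. change (val x = ur u) in E. rewrite E in H. exact H.
Qed.

Lemma is_set_inv (x : Model) : is_set x -> exists A (f : A -> pre), val x = sup f.
Proof.
  intros H. destruct (val x) as [u|A f] eqn:E; [|eauto].
  destruct H. now exists u.
Qed.

Lemma mem_inv (x : pre) (y : Model) : pmem x (val y) -> exists z : Model, eqv (val z) x.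
Proof.
  intros H. apply point_of. assert (Hy := val_hsym y).
  destruct (val y) as [u|A f]; [contradiction|].
  destruct H as [a Ha]. apply (@hsym_eqv (f a)); [now apply eqv_sym|]. apply Hy.
Qed.

Lemma urel_no_mem (a x : Model) : urel a -> x ∉ a.
Proof.
  intros [u E] H. change (pmem (val x) (val a)) in H.
  change (val a = ur u) in E. rewrite E in H. exact H.
Qed.

Lemma model_ext (x y : Model) :
  is_set x -> is_set y -> (forall z, z ∈ x <-> z ∈ y) -> x = y.
Proof.
  intros Hx Hy H. apply val_inj.
  assert (P : forall z, pmem z (val x) <-> pmem z (val y)).
  { intros z; split; intros Hz; destruct (mem_inv Hz) as [w Hw];
      apply (pmem_eqv Hw (eqv_refl _)); apply H;
      exact (pmem_eqv (eqv_sym Hw) (eqv_refl _) Hz). }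
  destruct (is_set_inv Hx) as (A & f & Ex), (is_set_inv Hy) as (B & g & Ey).
  rewrite Ex, Ey in *. simpl in *. split; intros c.
  - apply P. exists c. apply eqv_refl.
  - destruct (proj2 (P (g c))) as [a Ha]; [exists c; apply eqv_refl|].
    exists a. now apply eqv_sym.
Qed.

Lemma model_wf : well_founded (fun x y : Model => x ∈ y).
Proof.
  (* Members of a set are only equivalent to its branches, so the induction is on any [p] equivalent
     to the value of [x]. *)
  enough (H : forall p (x : Model), eqv (val x) p -> Acc (fun x y : Model => x ∈ y) x).
  { intros x. exact (H _ x (eqv_refl _)). }
  induction p as [u|A f IH]; intros x Hx; constructor; intros y Hy;
    apply (pmem_eqv (eqv_refl _) Hx) in Hy; [contradiction|].
  destruct Hy as [a Ha]. now apply (IH a).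
Qed.

(** * Flips as automorphisms of the model *)

Definition act (π : label -> bool) (x : Model) : Model := cls (hsym_pact π (val_hsym x)).

Lemma val_act π x : eqv (val (act π x)) (pact π (val x)).
Proof. apply val_cls. Qed.

Lemma act_act π x : act π (act π x) = x.
Proof.
  apply val_inj. eapply eqv_trans; [apply val_act|].
  eapply eqv_trans; [apply pact_eqv, val_act|]. rewrite pact_pact. apply eqv_refl.
Qed.

Lemma act_mem π (x y : Model) : act π x ∈ act π y <-> x ∈ y.
Proof.
  assert (H : forall x y : Model, x ∈ y -> act π x ∈ act π y).
  { intros v w Hvw. apply (pact_mem π) in Hvw.
    exact (pmem_eqv (eqv_sym (val_act π v)) (eqv_sym (val_act π w)) Hvw). }
  split; auto. intros Hxy. rewrite <- (act_act π x), <- (act_act π y). auto.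
Qed.

Lemma act_urel π (x : Model) : urel (act π x) <-> urel x.
Proof.
  assert (H : forall x : Model, urel x -> urel (act π x)).
  { intros y. rewrite !urel_eqv. intros [u Hu]. exists (flip π u).
    eapply eqv_trans; [apply val_act|]. exact (pact_eqv π Hu). }
  split; auto. intros Hx. rewrite <- (act_act π x). auto.
Qed.

Lemma act_mem_l π (x y : Model) : act π x ∈ y <-> x ∈ act π y.
Proof. now rewrite <- (act_mem π x), act_act. Qed.

Lemma act_eq π (x y : Model) : act π x = act π y <-> x = y.
Proof.
  split; [|now intros ->]. intros H. now rewrite <- (act_act π x), H, act_act.
Qed.

(** Countably many countable supports are merged into one along Cantor's pairing function. This is
    what allows infinitely many parameters in [comprehension]. *)
Lemma seq_support (s : nat -> Model) :
  exists E, forall π, fixes π E -> forall k, act π (s k) = s k.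
Proof.
  assert (H : forall k, exists E, forall π, fixes π E -> act π (s k) = s k).
  { intros k. destruct (hsym_sym (val_hsym (s k))) as [E HE]. exists E.
    intros π Hπ. apply val_inj. eapply eqv_trans; [apply val_act|]. auto. }
  set (E k := proj1_sig (constructive_indefinite_description _ (H k))).
  exists (fun m => E (fst (Cantor.of_nat m)) (snd (Cantor.of_nat m))).
  intros π Hπ k. unfold E in Hπ.
  apply (proj2_sig (constructive_indefinite_description _ (H k))).
  intros n. specialize (Hπ (Cantor.to_nat (k, n))).
  cbv beta in Hπ. now rewrite Cantor.cancel_of_to in Hπ.
Qed.

(** * Smallness and comprehension *)

Definition small (P : Model -> Prop) : Prop :=
  exists (A : Type) (f : A -> Model), forall z, P z -> exists a, f a = z.

Lemma small_sub (P Q : Model -> Prop) : (forall z, P z -> Q z) -> small Q -> small P.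
Proof. intros H (A & f & Hf). exists A, f. auto. Qed.

Lemma small_mem (x : Model) : small (fun z => z ∈ x).
Proof.
  destruct (classic (is_set x)) as [H|H].
  - destruct (is_set_inv H) as (A & f & E).
    assert (Hf : forall a, hsym (f a)).
    { intros a. generalize (val_hsym x). rewrite E. intros Hx. apply Hx. }
    exists A, (fun a => cls (Hf a)). intros z Hz.
    change (pmem (val z) (val x)) in Hz. rewrite E in Hz. destruct Hz as [a Ha].
    exists a. apply val_inj. eapply eqv_trans; [apply val_cls|].
    now apply eqv_sym.
  - exists Empty_set, (fun a : Empty_set => match a with end). intros z Hz.
    apply NNPP in H. destruct (urel_no_mem H Hz).
Qed.

Lemma small_eq (x : Model) : small (fun z => z = x).
Proof. exists unit, (fun _ => x). intros z ->. now exists tt. Qed.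

Lemma small_bind (Q : Model -> Prop) (R : Model -> Model -> Prop) :
  small Q -> (forall y, Q y -> small (R y)) ->
  small (fun z => exists y, Q y /\ R y z).
Proof.
  intros (A & f & Hf) HR.
  (* A cover is chosen for every [y], with the empty family as default outside [Q]. *)
  assert (H : forall y, exists p : {B : Type & B -> Model},
    Q y -> forall z, R y z -> exists b, projT2 p b = z).
  { intros y. destruct (classic (Q y)) as [Hy|Hy].
    - destruct (HR y Hy) as (B & g & Hg). now exists (existT (fun B : Type => B -> Model) B g).
    - exists (existT (fun B : Type => B -> Model) Empty_set (fun a : Empty_set => match a with end)). tauto. }
  set (p y := constructive_indefinite_description _ (H y)).
  exists {a : A & projT1 (proj1_sig (p (f a)))},
    (fun c => projT2 (proj1_sig (p (f (projT1 c)))) (projT2 c)).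
  intros z (y & Hy & Hz). destruct (Hf y Hy) as [a <-].
  destruct (proj2_sig (p (f a)) Hy z Hz) as [b Hb]. now exists (existT _ a b).
Qed.

Lemma small_or (P Q : Model -> Prop) : small P -> small Q -> small (fun z => P z \/ Q z).
Proof.
  intros (A & f & Hf) (B & g & Hg).
  exists (A + B)%type, (fun c => match c with inl a => f a | inr b => g b end).
  intros z [H|H].
  - destruct (Hf z H) as [a Ha]. now exists (inl a).
  - destruct (Hg z H) as [b Hb]. now exists (inr b).
Qed.

(** Replacement at the level of types. Although [z] ranges over the whole model, the existential
    lies in [Prop], so the subtype of indices that have a value stays in the universe of [A]. *)
Lemma small_functional (A : Type) (R : A -> Model -> Prop) :
  (forall a z z', R a z -> R a z' -> z = z') -> small (fun z => exists a, R a z).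
Proof.
  intros HR. exists {a | exists z, R a z},
    (fun c => proj1_sig (constructive_indefinite_description (R (proj1_sig c)) (proj2_sig c))).
  intros z [a Ha]. exists (exist _ a (ex_intro _ z Ha)).
  destruct constructive_indefinite_description as [z' Hz']. simpl in *. eauto.
Qed.

Lemma small_iUnion (P : nat -> Model -> Prop) :
  (forall n, small (P n)) -> small (fun z => exists n, P n z).
Proof.
  intros H.
  assert (H' : forall n, exists p : {B : Type & B -> Model},
    forall z, P n z -> exists b, projT2 p b = z).
  { intros n. destruct (H n) as (B & g & Hg). now exists (existT (fun B : Type => B -> Model) B g). }
  set (p n := constructive_indefinite_description _ (H' n)).
  exists {n & projT1 (proj1_sig (p n))},
    (fun c => projT2 (proj1_sig (p (projT1 c))) (projT2 c)).
  intros z [n Hn]. destruct (proj2_sig (p n) z Hn) as [b Hb]. now exists (existT _ n b).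
Qed.

(** The group itself is too large to index the orbit. But the effect of [π] on a fixed [x] depends
    only on a small invariant [q π]: a single bit at an urelement, and the family of the invariants
    of the branches at a set. *)
Lemma small_orbit (x : Model) : small (fun z => exists π, z = act π x).
Proof.
  assert (H : forall p, exists (A : Type) (q : (label -> bool) -> A),
    forall π σ, q π = q σ -> pact π p = pact σ p).
  { induction p as [[[k n] b]|A f IH].
    - exists bool, (fun π => π k). simpl. now intros π σ ->.
    - assert (IH' : forall a, exists s : {B : Type & (label -> bool) -> B},
        forall π σ, projT2 s π = projT2 s σ -> pact π (f a) = pact σ (f a)).
      { intros a. destruct (IH a) as (B & q & Hq). now exists (existT (fun B : Type => (label -> bool) -> B) B q). }
      set (s a := constructive_indefinite_description _ (IH' a)).
      exists (forall a, projT1 (proj1_sig (s a))), (fun π a => projT2 (proj1_sig (s a)) π).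
      intros π σ E. simpl. f_equal. apply functional_extensionality. intros a.
      apply (proj2_sig (s a)). exact (f_equal (fun h => h a) E). }
  destruct (H (val x)) as (A & q & Hq).
  apply (@small_sub _ (fun z => exists a, exists π, a = q π /\ z = act π x)).
  - intros z [π ->]. eauto.
  - apply small_functional. intros a z z' (π & -> & ->) (σ & E & ->).
    apply val_inj. eapply eqv_trans; [apply val_act|]. rewrite (Hq _ _ E).
    apply eqv_sym, val_act.
Qed.

(** The source of all sets of the model built below. A common support of the parameters supports the
    new set, since its members are permuted by every [π] that fixes the parameters. *)
Lemma comprehension (s : nat -> Model) (P : Model -> Prop) :
  small P ->
  (forall π, (forall k, act π (s k) = s k) -> forall z, P z -> P (act π z)) ->
  exists y : Model, is_set y /\ forall z, z ∈ y <-> P z.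
Proof.
  intros (A & f & Hf) HP.
  set (p := sup (fun a : {a | P (f a)} => val (f (proj1_sig a)))).
  assert (Hp : forall z : Model, pmem (val z) p <-> P z).
  { intros z. split.
    - intros [[a Ha] E]. apply val_inj in E. simpl in E. now subst.
    - intros Hz. destruct (Hf z Hz) as [a <-]. exists (exist _ a Hz). apply eqv_refl. }
  assert (Hs : hsym p).
  { split; [|intros a; apply val_hsym].
    destruct (seq_support s) as [E HE]. exists E. intros π Hπ. specialize (HP π (HE π Hπ)).
    assert (C : forall a : {a | P (f a)}, exists b : {a | P (f a)},
      eqv (pact π (val (f (proj1_sig a)))) (val (f (proj1_sig b)))).
    { intros [a Ha]. destruct (Hf _ (HP _ Ha)) as [b Hb].
      assert (Pb : P (f b)) by (rewrite Hb; auto).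
      exists (exist _ b Pb). simpl. rewrite Hb. apply eqv_sym, val_act. }
    (* Since [π] is an involution, the converse half of the bisimulation follows from the first. *)
    split; [exact C|]. intros b. destruct (C b) as [a Ha]. exists a.
    apply (pact_eqv π) in Ha. rewrite pact_pact in Ha. now apply eqv_sym. }
  exists (cls Hs). split; [exact (is_set_sup (val_cls Hs))|]. intros z. rewrite <- Hp.
  split; apply pmem_eqv; auto using eqv_refl, eqv_sym, val_cls.
Qed.

(** * The axioms of ZU and replacement *)

Lemma sat_in_ext (M : structure) (D : M -> Prop) φ : forall e e' : nat -> M,
  (forall k, free φ k -> e k = e' k) -> sat_in D φ e <-> sat_in D φ e'.
Proof.
  induction φ as [|i j|i j|[] i|φ1 IH1 φ2 IH2|φ IH]; intros e e' H; simpl in *.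
  - tauto.
  - rewrite (H i), (H j) by auto. tauto.
  - rewrite (H i), (H j) by auto. tauto.
  - rewrite (H i) by auto. tauto.
  - rewrite (IH1 e e'), (IH2 e e') by auto. tauto.
  - split; intros Hx x Dx; (apply (IH (x .: e) (x .: e')); [|now apply Hx]);
      intros [|k] Hk; simpl; auto.
Qed.

Lemma sat_act π φ : forall e : nat -> Model, sat φ (fun k => act π (e k)) <-> sat φ e.
Proof.
  unfold sat. induction φ as [|i j|i j|[] i|φ1 IH1 φ2 IH2|φ IH]; intros e; simpl.
  - tauto.
  - apply act_eq.
  - apply (act_mem π (e i) (e j)).
  - apply (act_urel π (e i)).
  - rewrite IH1, IH2. tauto.
  - assert (E : forall x, sat_in (fun _ => True) φ (act π x .: fun k => act π (e k))
                     <-> sat_in (fun _ => True) φ (x .: e)).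
    { intros x. rewrite <- (IH (x .: e)). apply sat_in_ext. now intros [|k] _. }
    split; intros H x _.
    + apply E. now apply H.
    + rewrite <- (act_act π x). apply E. now apply H.
Qed.

Lemma sat_act_fixed π φ (e : nat -> Model) x : (forall k, act π (e k) = e k) ->
  sat φ (act π x .: e) <-> sat φ (x .: e).
Proof.
  intros H. rewrite <- (sat_act π φ (x .: e)). apply sat_in_ext.
  intros [|k] _; simpl; auto.
Qed.

Lemma sat_act_fixed2 π φ (e : nat -> Model) x y : (forall k, act π (e k) = e k) ->
  sat φ (act π x .: act π y .: e) <-> sat φ (x .: y .: e).
Proof.
  intros H. rewrite <- (sat_act π φ (x .: y .: e)). apply sat_in_ext.
  intros [|[|k]] _; simpl; auto.
Qed.

Lemma act_set π (x : Model) : is_set (act π x) <-> is_set x.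
Proof. unfold is_set. now rewrite act_urel. Qed.

Lemma act_fixed_mem π (x z : Model) : act π x = x -> act π z ∈ x <-> z ∈ x.
Proof. intros H. now rewrite act_mem_l, H. Qed.

Lemma comprehension1 (x : Model) (P : Model -> Prop) :
  small P -> (forall π, act π x = x -> forall z, P z -> P (act π z)) ->
  exists y : Model, is_set y /\ forall z, z ∈ y <-> P z.
Proof.
  intros HP Hx. apply (@comprehension (fun _ => x)); [exact HP|].
  intros π Hπ. exact (Hx π (Hπ 0)).
Qed.

(** * Pairs and numerals, and the action on them *)

Lemma ex_empty : exists x : Model, empty x.
Proof.
  (* An urelement serves as the parameter of [comprehension1], urelements being the points at hand
     so far. *)
  assert (u : atom) by exact ((node (fun a : Empty_set => match a with end), fun _ => true), 0, true).
  destruct (@comprehension1 (cls (hsym_ur u)) (fun _ => False)) as (y & Hy & Hz).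
  - exists Empty_set, (fun a : Empty_set => match a with end). tauto.
  - tauto.
  - exists y. split; auto. intros z. now rewrite Hz.
Qed.

Definition emp : Model := proj1_sig (constructive_indefinite_description _ ex_empty).

Lemma emp_spec : empty emp.
Proof. exact (proj2_sig (constructive_indefinite_description _ ex_empty)). Qed.

Lemma ex_adj (x y : Model) :
  exists z : Model, is_set z /\ forall v, v ∈ z <-> v ∈ x \/ v = y.
Proof.
  apply (@comprehension (x .: fun _ => y)).
  - apply small_or; [apply small_mem|apply small_eq].
  - intros π Hπ z [Hz| ->].
    + left. apply act_fixed_mem; [exact (Hπ 0)|exact Hz].
    + right. exact (Hπ 1).
Qed.

Definition adj (x y : Model) : Model :=
  proj1_sig (constructive_indefinite_description _ (ex_adj x y)).

Lemma adj_set x y : is_set (adj x y).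
Proof. exact (proj1 (proj2_sig (constructive_indefinite_description _ (ex_adj x y)))). Qed.

Lemma adj_mem x y v : v ∈ adj x y <-> v ∈ x \/ v = y.
Proof. exact (proj2 (proj2_sig (constructive_indefinite_description _ (ex_adj x y))) v). Qed.

Lemma emp_mem v : v ∉ emp.
Proof. apply emp_spec. Qed.

Lemma act_emp π : act π emp = emp.
Proof.
  apply model_ext.
  - apply act_set, emp_spec.
  - apply emp_spec.
  - intros z. rewrite <- act_mem_l. split; intros H; now apply emp_mem in H.
Qed.

Lemma act_adj π x y : act π (adj x y) = adj (act π x) (act π y).
Proof.
  apply model_ext; [apply act_set, adj_set|apply adj_set|].
  intros z. rewrite <- act_mem_l, !adj_mem, act_mem_l.
  rewrite <- (act_eq π (act π z)), act_act. tauto.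
Qed.

Definition dup (x y : Model) : Model := adj (adj emp x) y.
Definition kpair (x y : Model) : Model := dup (dup x x) (dup x y).

Lemma dup_mem x y v : v ∈ dup x y <-> v = x \/ v = y.
Proof. unfold dup. rewrite !adj_mem. assert (H := @emp_mem v). tauto. Qed.

Lemma upair_dup (x y z : Model) : upair x y z <-> z = dup x y.
Proof.
  split.
  - intros [Hz H]. apply model_ext; [exact Hz|apply adj_set|].
    intros v. now rewrite H, dup_mem.
  - intros ->. split; [apply adj_set|apply dup_mem].
Qed.

Lemma opair_kpair (x y p : Model) : opair x y p <-> p = kpair x y.
Proof.
  split.
  - intros (s & t & Hs & Ht & Hp). apply upair_dup in Hs, Ht, Hp. now subst.
  - intros ->. exists (dup x x), (dup x y). now rewrite !upair_dup.
Qed.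

Lemma dup_inj x y x' y' : dup x y = dup x' y' -> (x = x' /\ y = y') \/ (x = y' /\ y = x').
Proof.
  intros E.
  assert (H : forall v, v = x \/ v = y <-> v = x' \/ v = y').
  { intros v. now rewrite <- !dup_mem, E. }
  destruct (proj1 (H x)), (proj1 (H y)), (proj2 (H x')), (proj2 (H y')); auto;
    subst; auto.
Qed.

Lemma kpair_inj x y x' y' : kpair x y = kpair x' y' -> x = x' /\ y = y'.
Proof.
  intros E. apply dup_inj in E as [[E1 E2]|[E1 E2]].
  - apply dup_inj in E1 as [[-> _]|[-> _]];
      apply dup_inj in E2 as [[? ?]|[? ?]]; subst; auto.
  - apply dup_inj in E1 as [[? ?]|[? ?]]; apply dup_inj in E2 as [[? ?]|[? ?]]; subst; auto.
Qed.

Lemma act_kpair π x y : act π (kpair x y) = kpair (act π x) (act π y).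
Proof. unfold kpair, dup. now rewrite !act_adj, act_emp. Qed.

Lemma maps_kpair (f x y : Model) : maps f x y <-> kpair x y ∈ f.
Proof.
  split.
  - intros (p & Hp & H). apply opair_kpair in Hp. now subst.
  - intros H. exists (kpair x y). now rewrite opair_kpair.
Qed.

Lemma act_maps π (f x y : Model) : act π f = f -> maps f (act π x) (act π y) <-> maps f x y.
Proof. intros H. rewrite !maps_kpair, <- act_kpair. now apply act_fixed_mem. Qed.

Fixpoint num (n : nat) : Model :=
  match n with 0 => emp | S n => adj (num n) (num n) end.

Lemma act_num π n : act π (num n) = num n.
Proof. induction n; simpl; [apply act_emp|]. now rewrite act_adj, IHn. Qed.

Lemma ex_omega : exists w : Model, is_set w /\ forall z, z ∈ w <-> exists n, z = num n.
Proof.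
  apply (@comprehension1 emp).
  - exists nat, num. intros z [n ->]. eauto.
  - intros π _ z [n ->]. exists n. apply act_num.
Qed.

Lemma succ_adj (x y : Model) : succ x y <-> y = adj x x.
Proof.
  split.
  - intros [Hy H]. apply model_ext; [exact Hy|apply adj_set|].
    intros v. now rewrite H, adj_mem.
  - intros ->. split; [apply adj_set|apply adj_mem].
Qed.

Lemma num_is_omega (w : Model) :
  is_set w -> (forall z, z ∈ w <-> exists n, z = num n) -> is_omega w.
Proof.
  intros Hw H. split; [split; [exact Hw|split]|].
  - exists emp. split; [apply emp_spec|]. apply H. now exists 0.
  - intros y Hy. apply H in Hy as [n ->]. exists (num (S n)). split.
    + now apply succ_adj.
    + apply H. eauto.
  - intros x (Hx & (y & Hy & Hyx) & Hs) z Hz. apply H in Hz as [n ->].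
    induction n as [|n IH]; simpl.
    + replace emp with y; [exact Hyx|]. apply model_ext; [apply Hy|apply emp_spec|].
      intros v. split; intros Hv; [now apply Hy in Hv|now apply emp_mem in Hv].
    + destruct (Hs _ IH) as (s & Es & Hsx). apply succ_adj in Es. now subst.
Qed.

(** * Verification of the individual axioms *)

Lemma model_foundation (x : Model) : (exists y, y ∈ x) ->
  exists y, y ∈ x /\ ~ exists z, z ∈ y /\ z ∈ x.
Proof.
  intros [y Hy]. revert Hy. induction (model_wf y) as [y _ IH]. intros Hy.
  destruct (classic (exists z, z ∈ y /\ z ∈ x)) as [(z & Hzy & Hzx)|H]; eauto.
Qed.

Lemma model_powerset (x : Model) : exists y, is_set y /\
  forall z, z ∈ y <-> is_set z /\ subset z x.
Proof.
  apply (@comprehension1 x).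
  - destruct (small_mem x) as (A & f & Hf).
    (* A subset of [x] is determined by a predicate on an index type for the members of [x], so
       these predicates index the powerset. *)
    apply (@small_sub _ (fun z => exists Q : A -> Prop,
      is_set z /\ forall v, v ∈ z <-> exists a, Q a /\ f a = v)).
    + intros z [Hz Hs]. exists (fun a => f a ∈ z). split; [exact Hz|].
      intros v. split; [|now intros (a & Ha & <-)].
      intros Hv. destruct (Hf v (Hs v Hv)) as [a <-]. eauto.
    + apply small_functional. intros Q z z' [Hz H] [Hz' H'].
      apply model_ext; auto. intros v. now rewrite H, H'.
  - intros π Hπ z [Hz Hs]. split; [now apply act_set|]. intros v Hv.
    rewrite <- act_mem_l in Hv. now apply (act_fixed_mem v Hπ), Hs.
Qed.

Lemma model_ZU : ZU Model.
Proof.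
  split.
  - exact urel_no_mem.
  - exact model_ext.
  - exact model_foundation.
  - intros x y. exists (dup x y). now apply upair_dup.
  - intros x. apply (@comprehension1 x).
    + apply small_bind; [apply small_mem|]. intros. apply small_mem.
    + intros π Hπ z (v & Hv & Hz). exists (act π v).
      now rewrite act_mem, act_fixed_mem.
  - exact model_powerset.
  - destruct ex_omega as (w & Hw & H). exists w. exact (proj1 (num_is_omega Hw H)).
  - intros φ e x. apply (@comprehension (x .: e)).
    + apply (@small_sub _ (fun z => z ∈ x)); [tauto|apply small_mem].
    + intros π Hπ z [Hz Hφ]. split.
      * apply act_fixed_mem; [exact (Hπ 0)|exact Hz].
      * apply sat_act_fixed; [|exact Hφ]. intros k. exact (Hπ (S k)).
Qed.

Lemma model_replacement : replacement Model.
Proof.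
  intros φ e w H.
  destruct (@comprehension (w .: e) (fun y => exists x, x ∈ w /\ sat φ (x .: y .: e)))
    as (v & Hv & E).
  - apply small_bind; [apply small_mem|]. intros x Hx.
    destruct (H x Hx) as (y & _ & U). apply (@small_sub _ (fun z => z = y)); [|apply small_eq].
    intros z Hz. symmetry. now apply U.
  - intros π Hπ y (x & Hx & Hφ). exists (act π x). split.
    + apply act_fixed_mem; [exact (Hπ 0)|exact Hx].
    + apply sat_act_fixed2; [|exact Hφ]. intros k. exact (Hπ (S k)).
  - exists v. split; [exact Hv|]. intros x Hx.
    destruct (H x Hx) as (y & Hy & _). exists y. split; [|exact Hy]. apply E. eauto.
Qed.

(** * Dependent choice *)

Lemma mem_irrefl (x : Model) : x ∉ x.
Proof. induction (model_wf x) as [x _ IH]. intros H. exact (IH x H H). Qed.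

Lemma num_mem n v : v ∈ num n <-> exists m, m < n /\ v = num m.
Proof.
  induction n as [|n IH].
  - split; [intros H; now apply emp_mem in H|intros (m & H & _); lia].
  - change (num (S n)) with (adj (num n) (num n)). rewrite adj_mem, IH. split.
    + intros [(m & Hm & ->)| ->]; [exists m|exists n]; auto with arith.
    + intros (m & Hm & ->). destruct (Nat.eq_dec m n) as [->|]; [now right|].
      left. exists m. split; [lia|reflexivity].
Qed.

Lemma num_inj n m : num n = num m -> n = m.
Proof.
  intros E. destruct (Nat.lt_total n m) as [H|[H|H]]; [exfalso|exact H|exfalso];
    apply (@mem_irrefl (num n)).
  - rewrite E at 2. apply num_mem. eauto.
  - rewrite E at 1. apply num_mem. eauto.
Qed.

Lemma model_DC : DC_omega_scheme Model.
Proof.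
  intros φ e H.
  (* The choice function [F] lives in the ambient type theory and need not be symmetric. *)
  set (F x := proj1_sig (constructive_indefinite_description _ (H x))).
  assert (HF : forall x, sat φ (x .: F x .: e)).
  { intros x. exact (proj2_sig (constructive_indefinite_description _ (H x))). }
  (* [r n] will be the restriction of the desired function to [n]. *)
  set (r := nat_rect (fun _ => point) emp (fun n g => adj g (kpair (num n) (F g)))).
  assert (Hr : forall n, is_set (r n : Model) /\
    forall p : Model, p ∈ (r n : Model) <-> exists m, m < n /\ p = kpair (num m) (F (r m))).
  { induction n as [|n [_ IH]].
    - split; [apply emp_spec|]. intros p.
      split; [intros Hp; now apply emp_mem in Hp|intros (m & Hm & _); lia].
    - change (r (S n)) with (adj (r n) (kpair (num n) (F (r n)))).
      split; [apply adj_set|]. intros p. rewrite adj_mem, IH. split.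
      + intros [(m & Hm & ->)| ->]; [exists m|exists n]; auto with arith.
      + intros (m & Hm & ->). destruct (Nat.eq_dec m n) as [->|]; [now right|].
        left. exists m. split; [lia|reflexivity]. }
  destruct ex_omega as (w & Hw & Ew).
  (* All values are taken as parameters at once. A map fixing each of them fixes every pair in the
     graph, because numerals are fixed by the whole group. *)
  destruct (@comprehension (fun n => F (r n))
    (fun p => exists n, p = kpair (num n) (F (r n)))) as (f & Hf & Ef).
  { exists nat, (fun n => kpair (num n) (F (r n))). intros z [n ->]. eauto. }
  { intros π Hπ z [n ->]. exists n. now rewrite act_kpair, act_num, Hπ. }
  assert (M : forall n y, maps f (num n) y <-> y = F (r n)).
  { intros n y. rewrite maps_kpair, Ef. split.
    - intros [m E]. apply kpair_inj in E as [E ->]. apply num_inj in E. now subst.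
    - intros ->. eauto. }
  exists w, f. split; [now apply num_is_omega|]. split.
  - split; [exact Hf|]. split; [exact Hw|]. split.
    + intros p Hp. apply Ef in Hp as [n ->]. exists (num n), (F (r n)).
      rewrite Ew, opair_kpair. eauto.
    + intros x Hx. apply Ew in Hx as [n ->]. exists (F (r n)). split; [now apply M|].
      intros y Hy. symmetry. now apply M.
  - intros x Hx. apply Ew in Hx as [n ->]. exists (r n), (F (r n)).
    split; [|split; [now apply M|apply HF]].
    split; [apply Hr|]. intros p. rewrite (proj2 (Hr n)), Ef. split.
    + intros (m & Hm & ->). split; [eauto|]. exists (num m), (F (r m)).
      rewrite num_mem, opair_kpair. eauto.
    + intros [[m ->] (x & y & Hx & Hp)]. apply opair_kpair, kpair_inj in Hp as [<- _].
      apply num_mem in Hx as (k & Hk & E). apply num_inj in E. subst. eauto.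
Qed.

(** * Reflection *)

(** The value is a counterexample rather than a witness because [All] is the primitive quantifier;
    it is arbitrary when there is none. *)
Definition skolem (ψ : form unit) (e : nat -> Model) : Model :=
  epsilon (inhabits emp) (fun x => ~ sat ψ (x .: e)).

(** Members give transitivity, orbits give invariance, and Skolem values give elementarity for all
    formulas simultaneously. The point [emp] is included to pad assignments outside the free
    variables. *)
Fixpoint stage (x : Model) (n : nat) (z : Model) : Prop :=
  match n with
  | 0 => z ∈ x \/ z = emp
  | S n => stage x n z \/
      (exists y, stage x n y /\ z ∈ y) \/
      (exists y, stage x n y /\ exists π, z = act π y) \/
      (exists a : form unit * (nat -> Model),
         (forall k, stage x n (snd a k)) /\ z = skolem (fst a) (snd a))
  end.

Definition hull (x z : Model) : Prop := exists n, stage x n z.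

Lemma stage_small x n : small (stage x n).
Proof.
  induction n as [|n IH]; simpl.
  - apply small_or; [apply small_mem|apply small_eq].
  - repeat apply small_or; auto.
    + apply small_bind; [exact IH|]. intros y _. apply small_mem.
    + apply small_bind; [exact IH|]. intros y _. apply small_orbit.
    + destruct IH as (A & f & Hf).
      (* Assignments into the stage are coded by sequences of indices, so that pairs of a formula
         and an assignment form a small type. *)
      exists (form unit * (nat -> A))%type,
        (fun a => skolem (fst a) (fun k => f (snd a k))).
      intros z ([ψ e] & He & ->). simpl in *.
      exists (ψ, fun k => proj1_sig (constructive_indefinite_description _ (Hf _ (He k)))).
      simpl. f_equal. apply functional_extensionality. intros k.
      now destruct constructive_indefinite_description.
Qed.

Lemma stage_mono x n m z : n <= m -> stage x n z -> stage x m z.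
Proof. induction 1; simpl; auto. Qed.

(** Stages increase, so finitely many points of the hull share a stage; an infinite sequence might
    not, hence the bound [N]. *)
Lemma hull_stage x (e : nat -> Model) N :
  (forall k, k < N -> hull x (e k)) -> exists n, forall k, k < N -> stage x n (e k).
Proof.
  induction N as [|N IH]; intros H.
  - exists 0. lia.
  - destruct IH as [n Hn]; [auto with arith|]. destruct (H N) as [m Hm]; [auto with arith|].
    exists (max n m). intros k Hk. destruct (Nat.eq_dec k N) as [->|].
    + apply (@stage_mono _ m); [lia|exact Hm].
    + apply (@stage_mono _ n); [lia|]. apply Hn. lia.
Qed.

Lemma free_bound P (φ : form P) : exists N, forall k, free φ k -> k < N.
Proof.
  induction φ as [|i j|i j|p i|φ1 [N1 H1] φ2 [N2 H2]|φ [N H]]; simpl.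
  - exists 0. tauto.
  - exists (S (i + j)). lia.
  - exists (S (i + j)). lia.
  - exists (S i). lia.
  - exists (N1 + N2). intros k [Hk|Hk]; [apply H1 in Hk|apply H2 in Hk]; lia.
  - exists N. intros k Hk. apply H in Hk. lia.
Qed.

Lemma hull_skolem x φ (e : nat -> Model) :
  (forall k, free (All φ) k -> hull x (e k)) ->
  (exists y, ~ sat φ (y .: e)) -> exists y, hull x y /\ ~ sat φ (y .: e).
Proof.
  intros He Hy. destruct (free_bound (All φ)) as [N HN].
  (* Overwriting [e] with [emp] off the finitely many free variables brings the whole assignment
     into one stage. *)
  set (e' k := if excluded_middle_informative (free (All φ) k) then e k else emp).
  assert (E : forall y, sat φ (y .: e') <-> sat φ (y .: e)).
  { intros y. apply sat_in_ext. intros [|k] Hk; simpl; [reflexivity|].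
    unfold e'. now destruct excluded_middle_informative. }
  destruct (@hull_stage x e' N) as [n Hn].
  { intros k _. unfold e'. destruct excluded_middle_informative; auto.
    exists 0. now right. }
  exists (skolem φ e'). split.
  - exists (S n). right. right. right. exists (φ, e'). split; [|reflexivity].
    intros k. simpl. destruct (Nat.lt_ge_cases k N) as [Hk|Hk]; auto.
    unfold e'. destruct excluded_middle_informative as [Hf|_].
    + apply HN in Hf. lia.
    + apply (@stage_mono _ 0); [lia|]. now right.
  - rewrite <- E. unfold skolem. apply epsilon_spec. destruct Hy as [y Hy].
    exists y. now rewrite E.
Qed.

(** The Tarski-Vaught criterion: a universal statement that fails has a counterexample in the hull
    by [hull_skolem]. *)
Lemma hull_reflects x φ : forall e : nat -> Model,
  (forall k, free φ k -> hull x (e k)) -> sat φ e <-> sat_in (hull x) φ e.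
Proof.
  induction φ as [|i j|i j|[] i|φ1 IH1 φ2 IH2|φ IH]; intros e He; try reflexivity.
  - unfold sat in *. simpl in *. rewrite IH1, IH2 by auto. reflexivity.
  - assert (IH' : forall y, hull x y -> sat φ (y .: e) <-> sat_in (hull x) φ (y .: e)).
    { intros y Hy. apply IH. intros [|k] Hk; simpl; auto. }
    split.
    + intros H y Hy. apply IH'; [exact Hy|]. now apply H.
    + intros H y _. apply NNPP. intros Hn.
      destruct (@hull_skolem x φ e He (ex_intro _ y Hn)) as (z & Hz & Hnz).
      apply Hnz, IH', H; exact Hz.
Qed.

Lemma model_RP : RP Model.
Proof.
  intros φ x Hx.
  (* Closure under orbits makes the hull invariant under the whole group, even where [x] and the
     Skolem functions are not. *)
  destruct (@comprehension1 emp (hull x)) as (t & Ht & E).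
  - apply small_iUnion. apply stage_small.
  - intros π _ z [n Hn]. exists (S n). right. right. left. eauto.
  - exists t. split; [split; [exact Ht|]|split].
    + intros y Hy z Hz. apply E in Hy as [n Hn]. apply E. exists (S n). right. left. eauto.
    + intros z Hz. apply E. exists 0. now left.
    + replace (fun y => y ∈ t) with (hull x).
      * intros e He. apply hull_reflects. intros k Hk. now apply E, He.
      * apply functional_extensionality. intros z. apply propositional_extensionality.
        symmetry. apply E.
Qed.

(** * Failure of homogeneity *)

Definition uatom (u : atom) : Model := cls (hsym_ur u).

Lemma uatom_inj u v : uatom u = uatom v -> u = v.
Proof.
  intros E. assert (H := val_cls (hsym_ur u)). fold (uatom u) in H. rewrite E in H.
  symmetry. exact (eqv_trans (eqv_sym (val_cls (hsym_ur v))) H).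
Qed.

Lemma act_uatom π u : act π (uatom u) = uatom (flip π u).
Proof.
  apply val_inj. eapply eqv_trans; [apply val_act|].
  eapply eqv_trans; [apply pact_eqv, val_cls|]. apply eqv_sym, val_cls.
Qed.

Lemma urel_uatom (x : Model) : urel x <-> exists u, x = uatom u.
Proof.
  rewrite urel_eqv. split; intros [u H]; exists u.
  - apply val_inj. eapply eqv_trans; [exact H|]. apply eqv_sym, val_cls.
  - subst. apply val_cls.
Qed.

(** A flip changes only the bit, so conditions on the tree and the natural number cut out an
    invariant class. With the tree fixed this class is small. *)
Lemma ex_block (i : tree) (Q : nat -> Prop) : exists B : Model, urel_set B /\
  forall z, z ∈ B <-> exists t n b, Q n /\ z = uatom ((i, t), n, b).
Proof.
  destruct (@comprehension1 emp
    (fun z => exists t n b, Q n /\ z = uatom ((i, t), n, b))) as (B & HB & E).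
  - exists ((nat -> bool) * nat * bool)%type,
      (fun a => let '(t, n, b) := a in uatom ((i, t), n, b)).
    intros z (t & n & b & _ & ->). now exists (t, n, b).
  - intros π _ z (t & n & b & Hn & ->). rewrite act_uatom. simpl. eauto 6.
  - exists B. split; [split|]; auto. intros a Ha. apply E in Ha as (t & n & b & _ & ->).
    apply urel_uatom. eauto.
Qed.

(** Diagonalisation: the trees that occur in [A] are gathered as the children of one node, which by
    [node_not_child] differs from each of them. *)
Lemma fresh_tree (A : Model) :
  exists i, forall t n b, uatom ((i, t), n, b) ∉ A.
Proof.
  destruct (small_mem A) as (I & f & Hf).
  (* [g a] is the tree in the label of [f a], or an arbitrary tree if [f a] is no urelement. *)
  set (g a := epsilon (inhabits (@node Empty_set (fun a => match a with end)))
    (fun i => exists t n b, f a = uatom ((i, t), n, b))).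
  exists (node g). intros t n b H. destruct (Hf _ H) as [a Ha].
  apply (@node_not_child _ g a). unfold g.
  set (Q := fun i => exists t n b, f a = uatom ((i, t), n, b)).
  destruct (epsilon_spec (inhabits (@node Empty_set (fun a => match a with end))) Q)
    as (t' & n' & b' & E); [unfold Q; eauto|].
  fold Q in E. rewrite Ha in E. apply uatom_inj in E. injection E as E _ _ _.
  symmetry. exact E.
Qed.

(** The shift keeps label and bit, hence commutes with all flips, and its graph is invariant. *)
Lemma shift_bijection i (B C : Model) : is_set B -> is_set C ->
  (forall z, z ∈ B <-> exists t n b, True /\ z = uatom ((i, t), n, b)) ->
  (forall z, z ∈ C <-> exists t n b, n <> 0 /\ z = uatom ((i, t), n, b)) ->
  equinumerous B C.
Proof.
  intros HB HC EB EC.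
  destruct (@comprehension1 emp (fun p => exists t n b,
    p = kpair (uatom ((i, t), n, b)) (uatom ((i, t), S n, b)))) as (f & Hf & Ef).
  - exists ((nat -> bool) * nat * bool)%type, (fun a => let '(t, n, b) := a in
      kpair (uatom ((i, t), n, b)) (uatom ((i, t), S n, b))).
    intros z (t & n & b & ->). now exists (t, n, b).
  - intros π _ z (t & n & b & ->). rewrite act_kpair, !act_uatom. simpl. eauto.
  - assert (M : forall x y, maps f x y <-> exists t n b,
      x = uatom ((i, t), n, b) /\ y = uatom ((i, t), S n, b)).
    { intros x y. rewrite maps_kpair, Ef. split.
      - intros (t & n & b & E). apply kpair_inj in E. eauto.
      - intros (t & n & b & -> & ->). eauto. }
    exists f. split; [|split; [exact HC|split]].
    + split; [exact Hf|split; [exact HB|split]].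
      * intros p Hp. apply Ef in Hp as (t & n & b & ->).
        exists (uatom ((i, t), n, b)), (uatom ((i, t), S n, b)).
        rewrite EB, opair_kpair. eauto 8.
      * intros x Hx. apply EB in Hx as (t & n & b & _ & ->).
        exists (uatom ((i, t), S n, b)). split; [apply M; eauto|].
        intros y Hy. apply M in Hy as (t' & n' & b' & E & ->).
        apply uatom_inj in E. congruence.
    + intros x y Hxy. apply M in Hxy as (t & n & b & _ & ->). apply EC.
      exists t, (S n), b. now split.
    + intros y Hy. apply EC in Hy as (t & n & b & Hn & ->). destruct n as [|n]; [easy|].
      exists (uatom ((i, t), n, b)). split; [apply M; eauto|].
      intros x Hx. apply M in Hx as (t' & n' & b' & -> & E).
      apply uatom_inj in E. congruence.
Qed.

(** On urelements the automorphism is [p] where [p] is defined and the identity elsewhere; [C], as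
    the image of [B], contains the resulting values. *)
Lemma extension_urel_set (p B C x : Model) : urel_set B -> extension p B C -> x ∈ B ->
  (exists y, maps p x y /\ y ∈ C) \/ (~ (exists y, maps p x y) /\ x ∈ C).
Proof.
  intros [HB UB] (f & d & (Td & (_ & _ & Hf & _) & H1 & H2 & H3) & HBC) Hx.
  assert (Bd : B ∈ d).
  { apply maps_kpair in HBC. destruct (Hf _ HBC) as (u & v & Hu & E).
    apply opair_kpair, kpair_inj in E as [-> _]. exact Hu. }
  assert (xd : x ∈ d) by exact (proj2 Td B Bd x Hx).
  destruct (H3 B C HB HBC) as [_ EC].
  destruct (classic (exists y, maps p x y)) as [[y Hy]|Hn].
  - left. exists y. split; [exact Hy|]. apply EC. eauto.
  - right. split; [exact Hn|]. apply EC. eauto.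
Qed.

Lemma model_not_homogeneous (A : Model) : ~ homogeneous_over A.
Proof.
  intros Hom. destruct (fresh_tree A) as [i Hi].
  destruct (ex_block i (fun _ => True)) as (B & HB & EB).
  destruct (ex_block i (fun n => n <> 0)) as (C & HC & EC).
  destruct (Hom B C HB HC) as (p & (D & [_ UD] & (_ & _ & Hdom & Hfun) & _ & _ & Hbij) & Hext & _).
  { exact (shift_bijection (proj1 HB) (proj1 HC) EB EC). }
  { intros a Ha. split; intros H; [apply EB in H|apply EC in H];
      destruct H as (t & n & b & _ & ->); exact (Hi t n b Ha). }
  destruct (seq_support (fun _ => p)) as [E HE].
  (* Cantor's diagonal: [t] differs at [n] from the sequence in the [n]-th label of the support. *)
  set (t := fun n => negb (snd (E n) n)).
  assert (Ht : forall n, E n <> (i, t)).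
  { intros n Hn. assert (H : snd (E n) n = t n) by now rewrite Hn.
    unfold t in H. now destruct (snd (E n) n). }
  (* The flip at the single label [(i, t)]. *)
  set (π := fun k => if excluded_middle_informative (k = (i, t)) then true else false).
  assert (Hp : act π p = p).
  { refine (HE π _ 0). intros n. unfold π.
    destruct excluded_middle_informative; [now destruct (Ht n)|reflexivity]. }
  set (x := uatom ((i, t), 0, true)).
  assert (xB : x ∈ B) by (apply EB; now exists t, 0, true).
  assert (xC : x ∉ C).
  { intros H. apply EC in H as (t' & n & b & Hn & H). apply uatom_inj in H. congruence. }
  assert (pD : forall y z, maps p y z -> y ∈ D).
  { intros y z H. apply maps_kpair in H. destruct (Hdom _ H) as (u & v & Hu & H').
    apply opair_kpair, kpair_inj in H' as [-> _]. exact Hu. }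
  assert (pfun : forall y z z', maps p y z -> maps p y z' -> z = z').
  { intros y z z' H H'. destruct (Hfun y (pD _ _ H)) as (w & _ & U).
    now rewrite <- (U z H), <- (U z' H'). }
  destruct (classic (x ∈ D)) as [xD|xD].
  - destruct (Hbij x xD) as (y & Hy & _).
    assert (yB : y ∉ B).
    { intros H. destruct (extension_urel_set HB Hext H) as [(z & Hz & zC)|[Hn _]]; [|eauto].
      apply xC. now rewrite (pfun y x z Hy Hz). }
    assert (yπ : act π y = y).
    { destruct (proj1 (urel_uatom y) (UD y (pD _ _ Hy))) as [[[[j s] n] b] ->].
      rewrite act_uatom. simpl. unfold π. destruct excluded_middle_informative as [H|H].
      - destruct yB. apply EB. injection H as -> ->. eauto 6.
      - now rewrite xorb_false_r. }
    apply (act_maps y x Hp) in Hy as Hy'. rewrite yπ in Hy'.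
    assert (H := pfun _ _ _ Hy Hy'). unfold x in H. rewrite act_uatom in H.
    apply uatom_inj in H. simpl in H. unfold π in H.
    now destruct excluded_middle_informative.
  (* Outside the domain of [p] the point [x] is its own image, which would put it into [C]. *)
  - destruct (extension_urel_set HB Hext xB) as [(y & Hy & _)|[_ H]]; eauto.
Qed.

Theorem theorem2p38 :
  consistent ZF ->
  exists M : structure,
    ZFU_R M /\ DC_omega_scheme M /\ RP M /\
    forall A : M, urel_set A -> ~ homogeneous_over A.
Proof.
  intros _. exists Model. split; [|split; [|split]].
  - exact (conj model_ZU model_replacement).
  - exact model_DC.
  - exact model_RP.
  - intros A _. apply model_not_homogeneous.
Qed.
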